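(* Let $\alpha > 0$ and $c(s,t) := |s-t|^\alpha$ for $s,t \in \mathbb{R}$. Then there exist $n \in \mathbb{N}$ with $n > 2 + 2^\alpha$ and vectors $x = (x_i)_{i=1}^n, y = (y_i)_{i=1}^n \in \mathbb{R}^n$ with $x_1 < \dots < x_n$ and $y_1 < \dots < y_n$ such that $$F_{\mathrm{id}}(x,y) < \max_{\sigma \in S_n} F_\sigma(x,y) \qquad\text{and}\qquad F_{\text{a-id}}(x,y) < \max_{\sigma \in S_n} F_\sigma(x,y).$$ Moreover, the gap can become arbitrarily large for increasing $n$: for every $M > 0$ there exists $N \in \mathbb{N}$ such that for every $n \in \mathbb{N}$ with $n \ge N$ there exist $x, y \in \mathbb{R}^n$ with $x_1 < \dots < x_n$ and $y_1 < \dots < y_n$ such that $$\max_{\sigma \in S_n} F_\sigma(x,y) - F_{\mathrm{id}}(x,y) > M \qquad\text{and}\qquad \max_{\sigma \in S_n} F_\sigma(x,y) - F_{\text{a-id}}(x,y) > M.$$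
   Context: $S_n$ denotes the group of permutations of $\{1,\dots,n\}$. For $x = (x_i)_{i=1}^n$ and $y = (y_i)_{i=1}^n$ in $\mathbb{R}^n$ and $\sigma \in S_n$, the objective of the assignment problem is $$F_\sigma(x,y) := \frac12 \sum_{i,k=1}^n c(x_i,x_k)\, c(y_{\sigma(i)}, y_{\sigma(k)}) = \sum_{\substack{i,k=1\\ i<k}}^n c(x_i,x_k)\, c(y_{\sigma(i)}, y_{\sigma(k)}),$$ where $c(s,t) = |s-t|^\alpha$. The identity permutation is $\mathrm{id}(i) := i$ and the anti-identity permutation is $\text{a-id}(i) := n - i + 1$ for $i \in \{1,\dots,n\}$. *)

(* Defs.v *)
From mathcomp Require Import all_boot all_order all_algebra fingroup perm.
From mathcomp Require Import reals exp.

Set Implicit Arguments.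
Unset Strict Implicit.
Unset Printing Implicit Defensive.

Import Order.TTheory GRing.Theory Num.Theory.
Local Open Scope ring_scope.

(* Indices run over 'I_n = {0, ..., n - 1} instead of {1, ..., n}. *)

Definition cost (R : realType) (alpha s t : R) : R := `|s - t| `^ alpha.

Definition strictly_increasing (R : realType) (n : nat) (x : 'rV[R]_n) : Prop :=
  forall i j : 'I_n, (i < j)%N -> x 0 i < x 0 j.

Definition objective (R : realType) (alpha : R) (n : nat) (x y : 'rV[R]_n)
    (sigma : 'S_n) : R :=
  2^-1 * \sum_(i < n) \sum_(k < n)
    cost alpha (x 0 i) (x 0 k) * cost alpha (y 0 (sigma i)) (y 0 (sigma k)).

Definition id_perm (n : nat) : 'S_n := 1%g.

(* [rev_ord i] has value n - 1 - i, which is i |-> n - i + 1 with indices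
   starting from 0. *)
Definition anti_id_perm (n : nat) : 'S_n := perm (@rev_ord_inj n).

(* The iteration starts from a value of the objective, so that it yields its
   maximum over 'S_n; see [max_objective_ge] and [max_objective_attained]. *)
Definition max_objective (R : realType) (alpha : R) (n : nat) (x y : 'rV[R]_n) : R :=
  \big[Num.max/objective alpha x y (id_perm n)]_(sigma : 'S_n)
    objective alpha x y sigma.

Lemma max_objective_ge (R : realType) (alpha : R) (n : nat) (x y : 'rV[R]_n)
    (sigma : 'S_n) :
  objective alpha x y sigma <= max_objective alpha x y.
Proof. exact: le_bigmax. Qed.

Lemma max_objective_attained (R : realType) (alpha : R) (n : nat)
    (x y : 'rV[R]_n) :
  exists sigma : 'S_n, max_objective alpha x y = objective alpha x y sigma.
Proof.
rewrite /max_objective; elim/big_rec: _ => [|s m _ [t ->]].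
  by exists (id_perm n).
by rewrite maxEle; case: ifP => _; [exists t | exists s].
Qed.

Lemma costC (R : realType) (alpha s t : R) : cost alpha s t = cost alpha t s.
Proof. by rewrite /cost distrC. Qed.

Lemma objective_ltE (R : realType) (alpha : R) (n : nat) (x y : 'rV[R]_n)
    (sigma : 'S_n) : 0 < alpha ->
  objective alpha x y sigma =
  \sum_(i < n) \sum_(k < n | (i < k)%N)
    cost alpha (x 0 i) (x 0 k) * cost alpha (y 0 (sigma i)) (y 0 (sigma k)).
Proof.
move=> alpha_gt0; rewrite /objective.
set f := fun i k : 'I_n =>
  cost alpha (x 0 i) (x 0 k) * cost alpha (y 0 (sigma i)) (y 0 (sigma k)).
have fC i k : f i k = f k i by rewrite /f costC [X in _ * X]costC.
have f0 i : f i i = 0.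
  by rewrite /f /cost subrr normr0 powR0 ?mul0r // gt_eqF.
rewrite -[LHS]/(2^-1 * \sum_i \sum_k f i k).
rewrite -[RHS]/(\sum_(i < n) \sum_(k < n | (i < k)%N) f i k).
have -> : \sum_i \sum_k f i k = \sum_(i < n) \sum_(k < n | (i < k)%N) f i k
    + \sum_(i < n) \sum_(k < n | (k < i)%N) f i k.
  rewrite -big_split; apply: eq_bigr => i _ /=.
  rewrite (bigD1 i) //= f0 add0r (bigID (fun k : 'I_n => (i < k)%N)) /=.
  by congr (_ + _); apply: eq_bigl => k; rewrite -val_eqE /=; case: ltngtP.
rewrite [X in _ + X](exchange_big_dep xpredT) //=.
under [X in _ + X]eq_bigr => i _ do under eq_bigr => k _ do rewrite fC.
by rewrite -mulr2n mulrnAr -mulrnAl -[2^-1 *+ 2]mulr_natr mulVf ?mul1r // pnatr_eq0.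
Qed.

(* Main.v *)
Require Import Defs.
From mathcomp Require Import all_boot all_order all_algebra fingroup perm.
From mathcomp Require Import reals exp.
From mathcomp Require Import boolp classical_sets filter.
From mathcomp Require Import topology normedtype derive.
From mathcomp Require Import zify lra.

Set Implicit Arguments.
Unset Strict Implicit.
Unset Printing Implicit Defensive.

Import Order.TTheory GRing.Theory Num.Theory.
Import numFieldNormedType.Exports.
Local Open Scope ring_scope.

(** The counterexample is a small perturbation of
<<
  x = (-1, 0, ..., 0, 1),    y = (0, ..., 0, 1, 1).
>>
As the entries of [y] are 0 or 1, the objective of an assignment is the total
cost, between entries of [x], across the cut that separates the two entries
matched with the ones from all the others ([objective_indicator]). A monotone
assignment, increasing or decreasing, selects one end of [x] and one of the
zeros. Its cut contains the long edge of cost 2 `^ alpha, but only one unit of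
cost for each of the n - 2 other entries, since zeros have no cost among
themselves: the value is 2 `^ alpha + (n - 2) ([cut_end_middle]). Selecting both
ends loses the long edge but gains two units for each of the n - 2 zeros, which
gives 2 (n - 2) ([cut_both_ends]). The latter is larger as soon as
n > 2 + 2 `^ alpha, so neither monotone assignment is optimal.

The ties in [x] and [y] are then broken by adding e * i to the i-th entries. The
objective is continuous in e from the right at 0 ([cvg_objective_spread]), so
that both strict inequalities survive for some e > 0. Finally the objective is
homogeneous of degree alpha in [x] ([objective_scale]): dilating [x] makes the
two gaps as large as desired, already for each fixed n > 2 + 2 `^ alpha. *)

(** * Objectives as cuts *)

Lemma cost_id (R : realType) (alpha : R) (s : R) :
  0 < alpha -> cost alpha s s = 0.
Proof.
by move=> alpha_gt0; rewrite /cost subrr normr0 powR0 // gt_eqF.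
Qed.

(** For a 0/1 vector the cost between two of its entries is 1 or 0 according to
whether they differ, so the objective is the weight of the cut of the complete
graph on the entries of [x] that is determined by the positions of the ones. *)
Lemma objective_indicator (R : realType) (alpha : R) (n : nat)
    (x y : 'rV[R]_n) (sigma : 'S_n) (S : {set 'I_n}) : 0 < alpha ->
  (forall i, y 0 (sigma i) = (i \in S)%:R) ->
  objective alpha x y sigma =
  \sum_(i in S) \sum_(k in ~: S) cost alpha (x 0 i) (x 0 k).
Proof.
move=> alpha_gt0 yS; rewrite /objective.
set c := fun i k : 'I_n => cost alpha (x 0 i) (x 0 k).
have cost_bool (b d : bool) :
    cost alpha b%:R d%:R = (b && ~~ d)%:R + (~~ b && d)%:R :> R.
  case: b d => [] [] /=; rewrite ?cost_id ?add0r ?addr0 // /cost.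
  - by rewrite subr0 normr1 powR1.
  - by rewrite sub0r normrN normr1 powR1.
transitivity (2^-1 * ((\sum_i \sum_k c i k * ((i \in S) && (k \notin S))%:R)
    + (\sum_i \sum_k c i k * ((i \notin S) && (k \in S))%:R))).
  congr (_ * _); rewrite -big_split; apply: eq_bigr => i _ /=.
  rewrite -big_split; apply: eq_bigr => k _ /=.
  by rewrite !yS cost_bool mulrDr.
rewrite [X in _ * (_ + X)]exchange_big /=.
under [X in _ * (_ + X)]eq_bigr => i _ do
  under eq_bigr => k _ do rewrite andbC [c _ _]costC.
rewrite -(mulr2n (\sum_i _)) -[X in _ * X]mulr_natl mulKf ?pnatr_eq0 //.
rewrite [RHS]big_mkcond; apply: eq_bigr => i _ /=.
case: ifP => iS; last by rewrite big1 // => k _; rewrite mulr0.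
rewrite [RHS]big_mkcond; apply: eq_bigr => k _ /=.
by rewrite inE; case: (k \in S); rewrite ?mulr0 ?mulr1.
Qed.

(** Every interior point is at distance 1 from both ends, so this cut collects
two units of cost for each of the n - 2 interior points and avoids the single
large cost, the one between the ends. *)
Lemma cut_both_ends (R : realType) (alpha : R) (n : nat) (x : 'rV[R]_n)
    (p q : 'I_n) : p != q -> `|x 0 p| = 1 -> x 0 q = - x 0 p ->
  (forall k, k != p -> k != q -> x 0 k = 0) ->
  \sum_(i in [set p; q]) \sum_(k in ~: [set p; q]) cost alpha (x 0 i) (x 0 k)
  = (n - 2)%:R *+ 2.
Proof.
move=> pq xp xq x0; rewrite big_setU1 ?inE //= big_set1.
have card_rest : #|~: [set p; q]| = (n - 2)%N.
  by rewrite cardsCs finset.setCK cards2 pq card_ord.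
have far (i : 'I_n) : `|x 0 i| = 1 ->
    \sum_(k in ~: [set p; q]) cost alpha (x 0 i) (x 0 k) = (n - 2)%:R.
  move=> xi; rewrite -card_rest -sumr_const; apply: eq_bigr => k.
  rewrite !inE negb_or => /andP[kp kq].
  by rewrite (x0 _ kp kq) /cost subr0 xi powR1.
by rewrite !far ?xq ?normrN.
Qed.

(** The selected interior point coincides with all the other interior points,
hence contributes only its distance to the end [q]; the selected end [p]
contributes 2 `^ alpha for [q], but only 1 for each interior point. *)
Lemma cut_end_middle (R : realType) (alpha : R) (n : nat) (x : 'rV[R]_n)
    (p q a : 'I_n) : 0 < alpha -> p != q -> `|x 0 p| = 1 -> x 0 q = - x 0 p ->
  (forall k, k != p -> k != q -> x 0 k = 0) -> a != p -> a != q ->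
  \sum_(i in [set p; a]) \sum_(k in ~: [set p; a]) cost alpha (x 0 i) (x 0 k)
  = 2 `^ alpha + (n - 2)%:R.
Proof.
move=> alpha_gt0 pq xp xq x0 ap aq; have pa : p != a by rewrite eq_sym.
have xa : x 0 a = 0 by exact: x0.
have n_ge3 : (3 <= n)%N.
  have : (#|[set p; q; a]| <= n)%N by rewrite -[leqRHS]card_ord max_card.
  by rewrite finset.setUC cardsU1 !inE negb_or ap aq cards2 pq.
have card_rest : #|~: [set p; a]| = (n - 2)%N.
  by rewrite cardsCs finset.setCK cards2 pa card_ord.
have q_rest : q \in ~: [set p; a].
  by rewrite !inE negb_or (eq_sym q) pq (eq_sym q) aq.
rewrite big_setU1 ?inE //= big_set1 -big_split /=.
rewrite (bigD1 q) //=.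
have -> : cost alpha (x 0 p) (x 0 q) = 2 `^ alpha.
  by rewrite /cost xq opprK -mulr2n normrMn xp.
have -> : cost alpha (x 0 a) (x 0 q) = 1.
  by rewrite /cost xa xq opprK add0r xp powR1.
rewrite (eq_bigr (fun _ => 1)).
  rewrite sumr_const (_ : #|_| = (n - 3)%N); last first.
    transitivity #|(~: [set p; a]) :\ q|.
      by apply: eq_card => k; rewrite in_setD1 andbC.
    by have := cardsD1 q (~: [set p; a]); rewrite q_rest card_rest; lia.
  by rewrite -addrA nat1r; congr (_ + _%:R); lia.
move=> k /andP[]; rewrite !inE negb_or => /andP[kp ka] kq.
by rewrite /cost xa (x0 _ kp kq) !subr0 xp normr0 powR1 powR0 ?addr0 // gt_eqF.
Qed.

(** * Perturbation and dilation *)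

(** Adding a small multiple of the index breaks the ties of a weakly increasing
vector. *)
Definition spread (R : realType) (n : nat) (x : 'rV[R]_n) (e : R) : 'rV[R]_n :=
  \row_i (x 0 i + e * i%:R).

Lemma spread_increasing (R : realType) (n : nat) (x : 'rV[R]_n) (e : R) :
  (forall i j : 'I_n, (i < j)%N -> x 0 i <= x 0 j) -> 0 < e ->
  strictly_increasing (spread x e).
Proof.
by move=> x_le e_gt0 i j ij; rewrite !mxE ler_ltD ?x_le // ltr_pM2l // ltr_nat.
Qed.

Local Open Scope classical_set_scope.

Lemma continuous_powR_gt0 (R : realType) (alpha a : R) : 0 < a ->
  {for a, continuous (fun t : R => t `^ alpha)}.
Proof.
move=> a_gt0; apply/differentiable_continuous/derivable1_diffP.
by apply: derivable_powR; rewrite in_itv /= a_gt0.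
Qed.

(** Away from the diagonal this is continuity of a positive base to the power
[alpha]. On the diagonal the cost is e `^ alpha times a constant, and it is
here that [alpha] has to be positive. *)
Lemma cvg_cost_line (R : realType) (alpha : R) (s t u v : R) : 0 < alpha ->
  (fun e : R => cost alpha (s + e * u) (t + e * v)) @ 0^'+ --> cost alpha s t.
Proof.
move=> alpha_gt0; rewrite /cost.
have [->|st] := eqVneq s t.
  rewrite subrr normr0 powR0 ?gt_eqF //.
  rewrite -[X in _ --> X](mul0r (`|u - v| `^ alpha)).
  have power_cvg : (fun e : R => e `^ alpha * `|u - v| `^ alpha) @ 0^'+
      --> 0 * `|u - v| `^ alpha.
    by apply: cvgM; [exact: powR_cvg0|exact: cvg_cst].
  apply: cvg_trans power_cvg; apply: near_eq_cvg; near=> e.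
  have e_gt0 : 0 < e by near: e; exact: nbhs_right_gt.
  by rewrite opprD addrACA subrr add0r -mulrBr normrM powRM // ger0_norm // ltW.
apply: (@cvg_comp _ _ _ (fun e : R => `|s + e * u - (t + e * v)|)
  (fun r : R => r `^ alpha) _ (nbhs `|s - t|)); last first.
  by apply: continuous_powR_gt0; rewrite normr_gt0 subr_eq0.
apply: cvg_at_right_filter; apply: cvg_norm.
have line (a b : R) : (fun e : R => a + e * b) @ 0 --> a.
  rewrite -[X in _ --> X]addr0 -[X in a + X](mul0r b).
  by apply: cvgD; [exact: cvg_cst|apply: cvgM; [exact: cvg_id|exact: cvg_cst]].
exact: cvgB.
Unshelve. all: by end_near. Qed.

Lemma cvg_objective_spread (R : realType) (alpha : R) (n : nat)
    (x y : 'rV[R]_n) (sigma : 'S_n) : 0 < alpha ->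
  (fun e : R => objective alpha (spread x e) (spread y e) sigma) @ 0^'+
    --> objective alpha x y sigma.
Proof.
move=> alpha_gt0; apply: cvgM; first exact: cvg_cst.
apply: cvg_big => [|i _]; first exact: add_continuous.
apply: cvg_big => [|k _]; first exact: add_continuous.
under eq_fun => e do rewrite !mxE.
by apply: cvgM; exact: cvg_cost_line.
Qed.

(** Homogeneity of the cost turns any positive gap into an arbitrarily large
one. *)
Lemma objective_scale (R : realType) (alpha : R) (n : nat)
    (x y : 'rV[R]_n) (sigma : 'S_n) (t : R) : 0 <= t ->
  objective alpha (t *: x) y sigma = t `^ alpha * objective alpha x y sigma.
Proof.
move=> t_ge0; rewrite /objective mulrCA; congr (_ * _).
rewrite mulr_sumr; apply: eq_bigr => i _.
rewrite mulr_sumr; apply: eq_bigr => k _.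
by rewrite /cost !mxE -mulrBr normrM (ger0_norm t_ge0) powRM // mulrA.
Qed.

Local Close Scope classical_set_scope.

(** * The counterexample *)

(** The vector (-1, 0, ..., 0, 1). *)
Definition ends (R : realType) (n : nat) : 'rV[R]_n :=
  \row_i ((i.+1 == n)%:R - (i == 0 :> nat)%:R).

(** The vector (0, ..., 0, 1, 1). *)
Definition top_pair (R : realType) (n : nat) : 'rV[R]_n :=
  \row_i (n - 2 <= i)%:R.

(** Monotone assignments pair the two ones of [top_pair] with an end and its
neighbour, at the top for the identity and at the bottom for the anti-identity;
by symmetry both have the value 2 `^ alpha + (n - 2). Pairing the ones with the
two ends yields 2 (n - 2) instead, which is larger exactly under the assumption
on [n]. *)
Lemma ends_beat_monotone (R : realType) (alpha : R) (n : nat) :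
  0 < alpha -> 2 + 2 `^ alpha < n%:R ->
  exists sigma : 'S_n,
    objective alpha (ends R n) (top_pair R n) (id_perm n)
      < objective alpha (ends R n) (top_pair R n) sigma /\
    objective alpha (ends R n) (top_pair R n) (anti_id_perm n)
      < objective alpha (ends R n) (top_pair R n) sigma.
Proof.
move=> alpha_gt0 n_large.
have n_ge4 : (4 <= n)%N.
  rewrite -(ltr_nat R); apply: le_lt_trans n_large.
  have : 1 `^ alpha <= 2 `^ alpha :> R.
    by apply: ge0_ler_powR; rewrite ?nnegrE ?(ltW alpha_gt0) // ler1n.
  by rewrite powR1; lra.
case: n n_ge4 n_large => [|[|[|[|m]]]] // _ n_large.
pose i0 : 'I_m.+4 := ord0; pose i1 : 'I_m.+4 := Ordinal (isT : (1 < m.+4)%N).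
pose l0 : 'I_m.+4 := ord_max; pose l1 := rev_ord i1.
set x := ends _ _; set y := top_pair _ _.
have x_mid k : k != i0 -> k != l0 -> x 0 k = 0.
  by rewrite -!val_eqE mxE /= eqSS => /negPf-> /negPf->; rewrite subrr.
have xi0 : x 0 i0 = -1 by rewrite mxE /= sub0r.
have xl0 : x 0 l0 = 1 by rewrite mxE /= eqxx subr0.
have smaller : 2 `^ alpha + (m.+4 - 2)%:R < (m.+4 - 2)%:R *+ 2 :> R.
  move: n_large; rewrite mulr2n ltrD2r !subSS subn0.
  by rewrite -addn2 natrD addrC ltrD2r.
(* The preimage of the positions n - 2 and n - 1 of the ones under this
   transposition consists of the two ends. *)
exists (tperm i0 l1).
have -> : objective alpha x y (id_perm m.+4) = 2 `^ alpha + (m.+4 - 2)%:R.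
  rewrite (@objective_indicator _ _ _ _ _ _ [set l0; l1]) // => [|i].
    apply: (@cut_end_middle _ _ _ _ _ i0); rewrite ?xl0 ?xi0 ?normr1 //.
    - by move=> k kl ki; apply: x_mid.
    - by rewrite -val_eqE /=; lia.
  rewrite perm1 mxE !inE -!val_eqE /=; congr (_%:R); have := ltn_ord i; lia.
have -> : objective alpha x y (anti_id_perm m.+4)
    = 2 `^ alpha + (m.+4 - 2)%:R.
  rewrite (@objective_indicator _ _ _ _ _ _ [set i0; i1]) // => [|i].
    apply: (@cut_end_middle _ _ _ _ _ l0); rewrite ?xl0 ?xi0 ?normrN1 ?opprK //.
  rewrite permE mxE !inE -!val_eqE /=; congr (_%:R); have := ltn_ord i; lia.
suff -> : objective alpha x y (tperm i0 l1) = (m.+4 - 2)%:R *+ 2 by [].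
rewrite (@objective_indicator _ _ _ _ _ _ [set i0; l0]) // => [|i].
  by apply: cut_both_ends; rewrite ?xl0 ?xi0 ?normrN1 ?opprK.
rewrite mxE !inE; congr (_%:R).
case: tpermP => [->|->|/eqP + /eqP]; rewrite -!val_eqE /=.
all: have := ltn_ord i; lia.
Qed.

(** The strict inequalities between objectives are open conditions, so they
survive when ties in [ends] and [top_pair] are broken by a small amount. *)
Lemma ends_beat_monotone_strict (R : realType) (alpha : R) (n : nat) :
  0 < alpha -> 2 + 2 `^ alpha < n%:R ->
  exists x y : 'rV[R]_n, exists sigma : 'S_n,
    [/\ strictly_increasing x, strictly_increasing y,
        objective alpha x y (id_perm n) < objective alpha x y sigma &
        objective alpha x y (anti_id_perm n) < objective alpha x y sigma].
Proof.
move=> alpha_gt0 n_large.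
have [sigma [id_lt aid_lt]] := ends_beat_monotone alpha_gt0 n_large.
have persists tau :
    objective alpha (ends R n) (top_pair R n) tau
      < objective alpha (ends R n) (top_pair R n) sigma ->
    (\forall e \near (0 : R)^'+,
      objective alpha (spread (ends R n) e) (spread (top_pair R n) e) tau
      < objective alpha (spread (ends R n) e)
          (spread (top_pair R n) e) sigma)%classic.
  rewrite -subr_gt0 => gap; near=> e; rewrite -subr_gt0; near: e.
  by apply: (cvgr_gt _ _ _ gap); apply: cvgB; exact: cvg_objective_spread.
have [e [e_gt0 [id_lt_e aid_lt_e]]] := filter_ex
  (filterI (nbhs_right_gt (0 : R))
    (filterI (persists _ id_lt) (persists _ aid_lt))).
exists (spread (ends R n) e), (spread (top_pair R n) e), sigma; split.
- apply: spread_increasing e_gt0 => i j ij; rewrite !mxE.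
  have := ltn_ord j.
  by do 4 case: eqP => /= ?; move=> ?; (lra || lia).
- apply: spread_increasing e_gt0 => i j ij; rewrite !mxE ler_nat.
  by case: (leqP (n - 2) i) => // ni; rewrite (leq_trans ni (ltnW ij)).
- exact: id_lt_e.
- exact: aid_lt_e.
Unshelve. all: by end_near. Qed.

Theorem proposition1 (R : realType) (alpha : R) (alpha_gt0 : 0 < alpha) :
  (exists n : nat, 2 + 2 `^ alpha < n%:R /\
    exists x y : 'rV[R]_n,
      [/\ strictly_increasing x,
          strictly_increasing y,
          objective alpha x y (id_perm n) < max_objective alpha x y &
          objective alpha x y (anti_id_perm n) < max_objective alpha x y]) /\
  (forall M : R, 0 < M ->
    exists N : nat, forall n : nat, (N <= n)%N ->
      exists x y : 'rV[R]_n,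
        [/\ strictly_increasing x,
            strictly_increasing y,
            max_objective alpha x y - objective alpha x y (id_perm n) > M &
            max_objective alpha x y - objective alpha x y (anti_id_perm n) > M]).
Proof.
have large n : ((Num.truncn (2 + 2 `^ alpha)).+1 <= n)%N ->
    2 + 2 `^ alpha < n%:R :> R.
  move=> Nn; apply: lt_le_trans (truncnS_gt _) _; rewrite ler_nat //.
split.
  exists (Num.truncn (2 + 2 `^ alpha : R)).+1; split; first exact: large.
  have [x [y [sigma [x_incr y_incr id_lt aid_lt]]]] :=
    ends_beat_monotone_strict alpha_gt0 (large _ (leqnn _)).
  exists x, y; split=> //.
  - exact: lt_le_trans id_lt (max_objective_ge _ _ _ _).
  - exact: lt_le_trans aid_lt (max_objective_ge _ _ _ _).
move=> M M_gt0; exists (Num.truncn (2 + 2 `^ alpha : R)).+1 => n /large n_large.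
have [x [y [sigma [x_incr y_incr id_lt aid_lt]]]] :=
  ends_beat_monotone_strict alpha_gt0 n_large.
pose gap := Num.min
  (objective alpha x y sigma - objective alpha x y (id_perm n))
  (objective alpha x y sigma - objective alpha x y (anti_id_perm n)).
have gap_gt0 : 0 < gap by rewrite lt_min !subr_gt0 id_lt.
(* Scaling [x] by [t] multiplies every gap by [T], hence the smaller of the two
   gaps becomes M + 1. *)
pose T := (M + 1) / gap.
have T_gt0 : 0 < T by rewrite divr_gt0 // addr_gt0.
pose t := T `^ alpha^-1.
have t_gt0 : 0 < t by exact: powR_gt0.
have t_pow : t `^ alpha = T.
  by rewrite -powRrM mulVf ?gt_eqF // powRr1 // ltW.
have blow_up tau : gap <= objective alpha x y sigma - objective alpha x y tau ->
    max_objective alpha (t *: x) y - objective alpha (t *: x) y tau > M.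
  move=> gap_le; have := max_objective_ge alpha (t *: x) y sigma.
  rewrite !(objective_scale _ _ _ _ (ltW t_gt0)) t_pow => max_ge.
  have : T * gap <= T * (objective alpha x y sigma - objective alpha x y tau).
    by rewrite ler_pM2l.
  rewrite /T divfK ?gt_eqF // mulrBr -/T; lra.
exists (t *: x), y; split=> //.
- by move=> i j ij; rewrite !mxE ltr_pM2l // x_incr.
- by apply: blow_up; rewrite ge_min lexx.
- by apply: blow_up; rewrite ge_min lexx orbT.
Qed.
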